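(* Let $G$ be a finite simple cubic (3-regular) graph that is Hamiltonian and bipartite, of order $2m$, and suppose $G$ has symmetry factor $b \in \mathbb{N}$ (in the sense defined in the context). If $G$ has girth $g$, then $b \ge g/4 - 1/2$.
   Context: All graphs are finite, simple and undirected; the girth is the length of a shortest cycle. A Hamiltonian cubic bipartite graph $G$ of order $2m$ is said to have symmetry factor $b \in \mathbb{N}$ if (1) $b$ divides $m$, and (2) there is a labelling of the vertices of $G$ by $1, 2, \ldots, 2m$ such that $1 \to 2 \to \cdots \to 2m \to 1$ is a Hamiltonian cycle of $G$ and, writing $u_i$ for the unique neighbour of vertex $i$ not adjacent to it along this Hamiltonian cycle ($1 \le i \le 2m$), the following holds: whenever $1 \le i \le 2m$, $1 \le j \le 2b$ and $j \equiv i \pmod{2b}$, we have $u_i - i \equiv u_j - j \pmod{2m}$. *)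

(* Defs.v *)
From mathcomp Require Import all_boot all_order all_algebra.

Set Implicit Arguments.
Unset Strict Implicit.
Unset Printing Implicit Defensive.

Section Graphs.

Variables (T : finType) (e : rel T).

Definition simple_graph : Prop := symmetric e /\ irreflexive e.

Definition cubic : Prop := forall x, #|[set y | e x y]| = 3.

Definition bipartite : Prop :=
  exists col : T -> bool, forall x y, e x y -> col x != col y.

(* [ucycle] accepts [::] and, for a symmetric [e], the two ends of an edge. *)
Definition graph_cycle (c : seq T) : Prop := 3 <= size c /\ ucycle e c.

Definition hamiltonian_cycle (c : seq T) : Prop :=
  graph_cycle c /\ size c = #|T|.

Definition hamiltonian : Prop := exists c, hamiltonian_cycle c.

Definition has_girth (g : nat) : Prop :=
  (exists2 c, graph_cycle c & size c = g) /\
  (forall c, graph_cycle c -> g <= size c).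

Definition chord (c : seq T) (x y : T) : bool :=
  [&& e x y, y != next c x & y != prev c x].

(* [v i] is the vertex labelled [i], for 1 <= i <= 2m: that
   [v 1; ...; v (2m)] is a Hamiltonian cycle makes [v] a bijection from these
   labels onto [T].  [u i] is the label u_i of the unique neighbour of [v i]
   off this cycle.  Values of [v] and [u] outside 1..2m play no role. *)
Definition symmetry_factor (m b : nat) : Prop :=
  b %| m /\
  exists (v : nat -> T) (u : nat -> nat),
    let c := [seq v i | i <- iota 1 (2 * m)] in
    [/\ hamiltonian_cycle c,
        forall i, 1 <= i <= 2 * m -> 1 <= u i <= 2 * m,
        forall i k, 1 <= i <= 2 * m -> 1 <= k <= 2 * m ->
          (chord c (v i) (v k) <-> k = u i)
      & forall i j, 1 <= i <= 2 * m -> 1 <= j <= 2 * b ->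
          j = i %[mod 2 * b] ->
          ((u i)%:Z - i%:Z = (u j)%:Z - j%:Z %[mod (2 * m)%:Z])%Z].

End Graphs.

(* Main.v *)
Require Import Defs.
From mathcomp Require Import all_boot all_order all_algebra.
From mathcomp Require Import zify lra.

Set Implicit Arguments.
Unset Strict Implicit.
Unset Printing Implicit Defensive.

(** Let [u] be the label of the chord neighbour of vertex 1.  The chord at
    [1 + 2b] is the chord at 1 translated by [2b], so
    [1, ..., 1 + 2b, u + 2b, ..., u] is a cycle of length [4b + 2], unless the
    label segments [1, 1 + 2b] and [u, u + 2b] overlap modulo [2m].  If they
    overlap, [u] is within distance [2b] of 1 along the Hamiltonian cycle, and
    the chord at 1 closes an even shorter cycle.  Hence [g <= 4b + 2]. *)

Lemma last_iota (a n : nat) : last a (iota a.+1 n) = a + n.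
Proof. by elim: n a => [|n IHn] a /=; rewrite ?addn0 // IHn addSnnS. Qed.

Lemma rev_iotaS (a n : nat) : rev (iota a n.+1) = (a + n) :: rev (iota a n).
Proof. by rewrite -addn1 iotaD rev_cat. Qed.

(** The shape of the cycles built below: two runs of consecutive labels, joined at their ends by two
    further edges. *)
Lemma cycle_cat (T : Type) (e : rel T) (x y : T) (p q : seq T) :
  cycle e ((x :: p) ++ (y :: q)) =
  [&& path e x p, e (last x p) y, path e y q & e (last y q) x].
Proof. by rewrite /= rcons_cat cat_path /= rcons_path. Qed.

(** [prev] looks for [x] in the tail [p]; uniqueness makes that search fail, and the resulting index
    [size p] is that of the last entry. *)
Lemma prev_head_uniq (T : eqType) (x : T) (p : seq T) :
  uniq (x :: p) -> prev (x :: p) x = last x p.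
Proof.
case/andP=> x_notin _; rewrite prev_nth mem_head memNindex //.
by rewrite -[size p]/(size (x :: p)).-1 nth_last.
Qed.

Section LabelledCycles.

Variables (T : finType) (e : rel T) (n : nat) (v : nat -> T).
Hypothesis e_sym : symmetric e.
Hypothesis v_cycle : ucycle e [seq v i | i <- iota 1 n].

Lemma label_inj : {in [pred i | 1 <= i <= n] &, injective v}.
Proof.
case/andP: v_cycle => _ v_uniq i j; rewrite !inE => le_i le_j eq_v.
(* Labels start at 1 but positions at 0, so label [i] sits at position [i.-1]. *)
have [lt_i lt_j] : i.-1 < n /\ j.-1 < n by lia.
have := nth_uniq (v 0) (s := [seq v i | i <- iota 1 n]) (i := i.-1) (j := j.-1).
rewrite size_map size_iota => /(_ lt_i lt_j v_uniq).
rewrite !(nth_map 0) ?size_iota // !nth_iota // !add1n !prednK; [|lia|lia].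
by rewrite eq_v eqxx => /esym/eqP; lia.
Qed.

Lemma label_edge (i : nat) : 0 < i < n -> e (v i) (v i.+1).
Proof.
case/andP: v_cycle => v_cyc _ lt_i.
have n_gt0 : n = n.-1.+1 by lia.
move: v_cyc; rewrite n_gt0 /= rcons_path => /andP[/pathP v_path _].
have := v_path (v 0) i.-1.
rewrite size_map size_iota => /(_ ltac:(lia)).
rewrite (nth_map 0) ?size_iota ?nth_iota; [|lia|lia].
rewrite -[v 1 :: _]/(map v (iota 1 n.-1.+1)).
rewrite (nth_map 0) ?size_iota ?nth_iota; [|lia|lia].
by rewrite add2n add1n prednK; last by lia.
Qed.

Lemma label_close : 0 < n -> e (v n) (v 1).
Proof.
case/andP: v_cycle => v_cyc _ n_gt0.
move: v_cyc; have -> : n = n.-1.+1 by lia.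
by rewrite /= rcons_path last_map last_iota add1n => /andP[].
Qed.

Lemma label_path (i k : nat) :
  0 < i -> i + k <= n -> path e (v i) [seq v j | j <- iota i.+1 k].
Proof.
elim: k i => //= k IHk i i_gt0 le_n.
by rewrite label_edge ?IHk //; lia.
Qed.

Lemma label_rev_path (i k : nat) :
  0 < i -> i + k <= n -> path e (v (i + k)) [seq v j | j <- rev (iota i k)].
Proof.
elim: k => [|k IHk] // i_gt0 le_n.
rewrite rev_iotaS /= IHk //; last by lia.
by rewrite addnS e_sym label_edge //; lia.
Qed.

Lemma label_uniq (s : seq nat) :
  uniq s -> {subset s <= [pred i | 1 <= i <= n]} -> uniq (map v s).
Proof.
move=> s_uniq s_sub; rewrite map_inj_in_uniq // => i j /s_sub + /s_sub.
exact: label_inj.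
Qed.

Lemma segment_cycle (i k : nat) :
  0 < i -> i + k <= n -> 1 < k -> e (v (i + k)) (v i) ->
  graph_cycle e [seq v j | j <- iota i k.+1].
Proof.
move=> i_gt0 le_n k_gt1 e_close; split; first by rewrite size_map size_iota.
apply/andP; split.
  by rewrite /= rcons_path label_path //= last_map last_iota.
by apply: label_uniq (iota_uniq _ _) _ => j; rewrite mem_iota inE; lia.
Qed.

(** The chord at 1 is closed the other way round, through the Hamiltonian edge from label [n] back
    to label 1. *)
Lemma wrapped_segment_cycle (i : nat) :
  1 < i < n -> e (v 1) (v i) ->
  graph_cycle e (v 1 :: [seq v j | j <- iota i (n - i).+1]).
Proof.
move=> lt_i e_close; split; first by rewrite /= size_map size_iota; lia.
apply/andP; split.
  rewrite (cycle_cat e (v 1) (v i) [::] [seq v j | j <- iota i.+1 (n - i)]).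
  rewrite last_map last_iota subnKC ?label_path ?e_close ?label_close //; lia.
rewrite -[_ :: _]/(map v (1 :: iota i (n - i).+1)); apply: label_uniq.
  by rewrite cons_uniq iota_uniq mem_iota; lia.
by move=> j; rewrite in_cons mem_iota inE; lia.
Qed.

(** Ascend from [i] to [i + k], cross to [j + k], descend to [j] and cross back. The bound
    [i + k < j] keeps the two segments disjoint. *)
Lemma two_segment_cycle (i j k : nat) :
  0 < i -> 0 < k -> i + k < j -> j + k <= n ->
  e (v i) (v j) -> e (v (i + k)) (v (j + k)) ->
  graph_cycle e
    [seq v l | l <- iota i k.+1 ++ rev (iota j k.+1)].
Proof.
move=> i_gt0 k_gt0 lt_ij le_n e_ij e_ijk; split.
  by rewrite size_map size_cat size_rev !size_iota; lia.
apply/andP; split.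
  rewrite map_cat rev_iotaS -[map v (iota i _)]/(v i :: map v (iota i.+1 k)).
  rewrite map_cons cycle_cat last_map last_iota e_ijk.
  rewrite label_path ?label_rev_path //=; [|lia|lia].
  (* As [k > 0], the descent below [j + k] is nonempty and ends at [j]. *)
  rewrite last_map -(prednK k_gt0) /= rev_cons last_rcons e_sym //.
apply: label_uniq.
  rewrite cat_uniq rev_uniq !iota_uniq andbT.
  by apply/hasPn => l; rewrite mem_rev inE !mem_iota; lia.
by move=> l; rewrite mem_cat mem_rev !mem_iota inE; lia.
Qed.

End LabelledCycles.

Lemma girth_le_symmetry_factor (T : finType) (e : rel T) (m b g : nat) :
  simple_graph e -> symmetry_factor e m b -> has_girth e g -> g <= 4 * b + 2.
Proof.
move=> [e_sym e_irr] [b_dvd_m [v [u [[[c_ge3 c_cyc] _] u_range u_chord u_shift]]]].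
move=> [_ g_min]; set c := map v _ in c_ge3 c_cyc u_chord.
have m_ge2 : 1 < m by move: c_ge3; rewrite size_map size_iota; lia.
have b_gt0 : 0 < b by apply: dvdn_gt0 b_dvd_m; lia.
have le_b_m : b <= m by apply: dvdn_leq b_dvd_m; lia.
have chordE i : 1 <= i <= 2 * m -> chord e c (v i) (v (u i)).
  by move=> i_range; apply/u_chord => //; apply: u_range.
have ham_m : 2 * m = (2 * m).-2.+2 by lia.
have u1_range := u_range 1 ltac:(lia).
have /and3P[e_1u u_next u_prev] := chordE 1 ltac:(lia).
(* Excluding 1, 2 and [2 * m] leaves [2 < u 1 < 2 * m], so that neither way of closing the chord at
   1 degenerates. *)
have u1_neq1 : u 1 != 1.
  by apply/eqP => u1; move: e_1u; rewrite u1 e_irr.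
have u1_neq2 : u 1 != 2.
  apply/eqP => u1; move: u_next.
  by rewrite u1 /c ham_m /= eqxx eqxx.
have u1_neq2m : u 1 != 2 * m.
  apply/eqP => u1; move: u_prev; case/andP: c_cyc => _.
  rewrite u1 /c ham_m -[iota 1 _]/(1 :: iota 2 (2 * m).-2.+1) map_cons.
  move=> c_uniq; rewrite prev_head_uniq //.
  by rewrite last_map last_iota add1n eqxx.
(* The cycle on labels 1 to [u 1] has length at most [2 * b + 1]. *)
case: (leqP (u 1) (2 * b).+1) => [u1_small|u1_large].
  have := segment_cycle c_cyc (i := 1) (k := (u 1).-1).
  rewrite add1n prednK; last by lia.
  rewrite e_sym => /(_ isT ltac:(lia) ltac:(lia) e_1u)/g_min.
  by rewrite size_map size_iota; lia.
(* Past [2 * m], the wrapped cycle has length [2 * m - u 1 + 2], again at most [2 * b + 1]. *)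
case: (leqP (u 1 + 2 * b) (2 * m)) => [le_2m|gt_2m]; last first.
  have /g_min := wrapped_segment_cycle c_cyc (i := u 1) ltac:(lia) e_1u.
  by rewrite /= size_map size_iota; lia.
(* The symmetry gives this only modulo [2 * m]; both sides lie between 1 and [2 * m], so the
   quotient [q] of their difference is 0. *)
have u_trans : u (1 + 2 * b) = u 1 + 2 * b.
  have range_1b : 1 <= 1 + 2 * b <= 2 * m by lia.
  have := u_range _ range_1b.
  have /= := u_shift (1 + 2 * b) 1 range_1b ltac:(lia).
  rewrite modnDr => /(_ erefl)/eqP; rewrite eqz_mod_dvd => /dvdzP[q] eq_q.
  move=> ub_range; have : (q = 0 \/ 1 <= q \/ q <= -1)%R by lia.
  case=> [q0|[q_pos|q_neg]]; first by move: eq_q; rewrite q0; lia.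
    have : ((2 * m)%:Z <= q * (2 * m)%:Z)%R by nia.
    lia.
  have : (q * (2 * m)%:Z <= - (2 * m)%:Z)%R by nia.
  lia.
have e_trans : e (v (1 + 2 * b)) (v (u 1 + 2 * b)).
  by rewrite -u_trans; case/and3P: (chordE (1 + 2 * b) ltac:(lia)).
(* Two segments of [2 * b + 1] labels each give the length [4 * b + 2]. *)
have /g_min := two_segment_cycle e_sym c_cyc (i := 1) (j := u 1) (k := 2 * b)
  isT ltac:(lia) ltac:(lia) le_2m e_1u e_trans.
by rewrite size_map size_cat size_rev !size_iota; lia.
Qed.

Theorem theorem1 (T : finType) (e : rel T) (m b g : nat)
    (e_simple : simple_graph e) (e_cubic : cubic e)
    (e_ham : hamiltonian e) (e_bip : bipartite e)
    (order_e : #|T| = 2 * m)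
    (e_sym : symmetry_factor e m b) (e_girth : has_girth e g) :
  (g%:R / 4%:R - 1 / 2%:R <= b%:R :> rat)%R.
Proof.
have := girth_le_symmetry_factor e_simple e_sym e_girth.
rewrite -(Num.Theory.ler_nat rat) GRing.natrD GRing.natrM.
lra.
Qed.
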